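(* There is a universal constant $c>0$ such that for every weakly observable directed graph $G$ with $N$ vertices and all sufficiently large $T$ (how large may depend on $G$), the mini-max regret satisfies $$R_G^*(T)\le c\,N^{\frac13}\cdot T^{\frac23}.$$
   Context: **Problem (bandit with graph feedback).** $G=(V,E)$ is a finite directed graph, possibly with self-loops; vertices are called arms. $N_{\mathrm{in}}(v)=\{u:(u,v)\in E\}$, $N_{\mathrm{out}}(v)=\{u:(v,u)\in E\}$. The player knows $G$ and the horizon $T$. In each round $t=1,\dots,T$ the player's (randomized) algorithm computes from past observations a distribution on $V$ and samples an arm $A_t$ from it; there is a loss vector $\ell^{(t)}:V\to[0,1]$; the player pays $\ell^{(t)}(A_t)$ and observes exactly the values $\ell^{(t)}(v)$ for $v\in N_{\mathrm{out}}(A_t)$. For an algorithm $\mathcal A$ and a fixed loss sequence $\mathcal L$, the regret with respect to arm $a$ is $R_a(G,T,\mathcal A,\mathcal L)=\mathbf E[\sum_{t=1}^T\ell^{(t)}(A_t)]-\sum_{t=1}^T\ell^{(t)}(a)$. The mini-max regret is $R_G^*(T)=\inf_{\mathcal A}\sup_{\mathcal L}R_{a^*}(G,T,\mathcal A,\mathcal L)$, where $a^*\in\arg\min_a\sum_t\ell^{(t)}(a)$. **Observability.** A vertex $v$ is non-observable if $N_{\mathrm{in}}(v)=\emptyset$; it is strongly observable if it has a self-loop or $N_{\mathrm{in}}(v)=V\setminus\{v\}$. A graph is non-observable if it has a non-observable vertex, strongly observable if all its vertices are strongly observable, and weakly observable if it is neither non-observable nor strongly observable. *)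

(* Defs.v *)
From HB Require Import structures.
From mathcomp Require Import all_boot all_order all_algebra.
From mathcomp Require Import all_classical all_reals all_analysis.

Set Implicit Arguments.
Unset Strict Implicit.
Unset Printing Implicit Defensive.

Import Order.TTheory GRing.Theory Num.Theory.

Local Open Scope ring_scope.
Local Open Scope classical_set_scope.

(* A directed graph, possibly with self-loops, is a finType V together with an
   arbitrary relation E : rel V, where E u v means that (u, v) is an edge. *)
Section Observability.
Variables (V : finType) (E : rel V).

Definition N_in (v : V) : {set V} := [set u | E u v]%SET.
Definition N_out (v : V) : {set V} := [set u | E v u]%SET.

Definition non_observable_vertex (v : V) : bool := N_in v == finset.set0.

Definition strongly_observable_vertex (v : V) : bool :=
  E v v || (N_in v == [set~ v]%SET).

Definition non_observable : bool := [exists v, non_observable_vertex v].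

Definition strongly_observable : bool :=
  [forall v, strongly_observable_vertex v].

Definition weakly_observable : bool :=
  ~~ non_observable && ~~ strongly_observable.

End Observability.

Section Bandit.
Variables (R : realType) (V : finType) (E : rel V).

(* What the player sees in a round where arm a is played and the loss vector
   is l: the values of l on N_out a, and None at every other arm. *)
Definition feedback (l : V -> R) (a : V) : {ffun V -> option R} :=
  [ffun v => if v \in N_out E a then Some (l v) else None].

(* The past rounds in chronological order, each recorded as the arm played and
   the feedback received. *)
Definition history : Type := seq (V * {ffun V -> option R}).

Definition is_distribution (p : V -> R) : Prop :=
  (forall v, 0 <= p v) /\ \sum_(v : V) p v = 1.

(* A randomized algorithm maps every history to the distribution from which the
   next arm is sampled.  The round number is the length of the history. *)
Definition is_algorithm (A : history -> V -> R) : Prop :=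
  forall h : history, is_distribution (A h).

(* Rounds are numbered 0, ..., T - 1; only L 0, ..., L (T - 1) matter below. *)
Definition is_loss_sequence (L : nat -> V -> R) : Prop :=
  forall t v, 0 <= L t v <= 1.

(* The history produced when the arms s_0, s_1, ... are played in this order. *)
Definition history_of (L : nat -> V -> R) (s : seq V) : history :=
  [seq (p.2, feedback (L p.1) p.2) | p <- zip (iota 0 (size s)) s].

(* The probability that (A_0, ..., A_(T-1)) = s: the loss sequence being fixed,
   it is the product over t of the conditional probabilities of s_t given the
   history of the rounds before t. *)
Definition play_prob (A : history -> V -> R) (L : nat -> V -> R) (T : nat)
    (s : T.-tuple V) : R :=
  \prod_(t < T) A (history_of L (take t s)) (tnth s t).

Definition expected_loss (T : nat) (A : history -> V -> R)
    (L : nat -> V -> R) : R :=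
  \sum_(s : T.-tuple V) play_prob A L s * \sum_(t < T) L t (tnth s t).

Definition cumulative_loss (T : nat) (L : nat -> V -> R) (a : V) : R :=
  \sum_(t < T) L t a.

Definition regret (T : nat) (A : history -> V -> R) (L : nat -> V -> R)
    (a : V) : R :=
  expected_loss T A L - cumulative_loss T L a.

Definition is_best_arm (T : nat) (L : nat -> V -> R) (a : V) : Prop :=
  forall b, cumulative_loss T L a <= cumulative_loss T L b.

(* The supremum over L of the regret with respect to a best arm; all best arms
   of L give the same regret, so letting a range over all of them is harmless. *)
Definition worst_case_regret (T : nat) (A : history -> V -> R) : \bar R :=
  ereal_sup [set x : \bar R | exists L a,
    [/\ is_loss_sequence L, is_best_arm T L a & x = (regret T A L a)%:E]].

Definition minimax_regret (T : nat) : \bar R :=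
  ereal_inf [set worst_case_regret T A | A in [set A | is_algorithm A]].

End Bandit.

(* Main.v *)
(* Online mirror descent with the 1/2-Tsallis potential, run on loss estimates
   obtained by forced exploration.  Fix an in-neighbour [f b] of every arm [b].
   With probability [gam] the player samples an arm [b] with probability
   proportional to [sqrt (p b)], where [p] is the current distribution, and
   plays [f b] in order to see the loss of [b]; otherwise it samples from [p].
   Uniform exploration and entropy would cost an extra logarithm; exploration
   proportional to [sqrt (p b)] makes the relevant variance term
   [sqrt (p a) / q a] at most [sqrt N / gam], while the potential is at most
   [sqrt N] initially.  Hence the regret is
   [O(sqrt N / eta + T (gam + eta sqrt N / gam))], and [gam = (N / T)^(1/3)],
   [eta = gam^2 / sqrt N] balances the three terms.
   Instead of the implicitly normalized mirror step, the update
   [p b := p b (1 - eta sqrt (p b) (e b - c))] is used, with the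
   [p^(3/2)]-weighted mean [c] of the estimates [e] keeping the total mass 1.
   The state is [x = sqrt p]. *)
Require Import Defs.
From HB Require Import structures.
From mathcomp Require Import all_boot all_order all_algebra.
From mathcomp Require Import all_classical all_reals all_analysis.
From mathcomp Require Import ring lra.

Set Implicit Arguments.
Unset Strict Implicit.
Unset Printing Implicit Defensive.

Import Order.TTheory GRing.Theory Num.Theory.

Local Open Scope ring_scope.

(** * Elementary upper bounds for [Num.sqrt (1 - u)] and its inverse *)

Section SquareRootBounds.
Variable R : realType.
Implicit Types u : R.

Lemma sqrt_1subr_le u : u <= 1 -> Num.sqrt (1 - u) <= 1 - u / 2.
Proof.
move=> u1; have g_ge0 : 0 <= 1 - u / 2 by lra.
rewrite -[leRHS](ger0_norm g_ge0) -sqrtr_sqr ler_sqrt ?sqr_ge0 // -subr_ge0.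
by rewrite [X in 0 <= X](_ : _ = (u / 2) ^+ 2) ?sqr_ge0 //; field.
Qed.

(** After squaring, the gap is [u ^+ 2] times a factor that is positive on this range; the Taylor
    coefficient 3/8 of [u ^+ 2] is relaxed to 1 to leave that room. *)
Lemma inv_sqrt_1subr_le u : - (1 / 2) <= u <= 1 / 2 ->
  (Num.sqrt (1 - u))^-1 <= 1 + u / 2 + u ^+ 2.
Proof.
move=> /andP[u_lo u_hi].
have s_gt0 : 0 < Num.sqrt (1 - u) by rewrite sqrtr_gt0; lra.
have g_gt0 : 0 < 1 + u / 2 + u ^+ 2 by nra.
rewrite -[leLHS]mul1r ler_pdivrMr //.
have s2 : Num.sqrt (1 - u) ^+ 2 = 1 - u by rewrite sqr_sqrtr; lra.
rewrite -(@ler_pXn2r _ 2) ?nnegrE ?ler01 //; last by rewrite mulr_ge0 ?ltW.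
rewrite exprMn s2 expr1n -subr_ge0.
have -> : (1 + u / 2 + u ^+ 2) ^+ 2 * (1 - u) - 1
  = u ^+ 2 * (5 / 4 * (1 - u) - u ^+ 3) by field.
apply: mulr_ge0; first exact: sqr_ge0.
nra.
Qed.

End SquareRootBounds.

(** * The mirror step and its effect on the potential *)

Section MirrorDescent.
Variables (R : realType) (V : finType).
Implicit Types (x e l : V -> R) (a b v : V).

Definition sqrt_distribution x : Prop :=
  (forall b, 0 < x b) /\ \sum_b x b ^+ 2 = 1.

Definition tilted_mean x e : R :=
  (\sum_b x b ^+ 3 * e b) / \sum_b x b ^+ 3.

Definition mirror_step (eta : R) x e b : R :=
  x b * Num.sqrt (1 - eta * x b * (e b - tilted_mean x e)).

(** With [p b = x b ^+ 2], this is the Bregman divergence of [- 2 * \sum_b Num.sqrt (p b)] from [p]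
    to the point mass at [a], shifted by the constant 2. *)
Definition potential a x : R := \sum_b x b + (x a)^-1.

Lemma sum_cube_gt0 x : sqrt_distribution x -> 0 < \sum_b x b ^+ 3.
Proof.
move=> [x_gt0 x1]; rewrite lt_neqAle sumr_ge0 ?andbT; last first.
  by move=> b _; rewrite exprn_ge0 // ltW.
apply/eqP => /esym/eqP; rewrite psumr_eq0; last first.
  by move=> b _; rewrite exprn_ge0 // ltW.
move=> /allP xall; have : \sum_b x b ^+ 2 = 0.
  apply: big1 => b _; have := xall b (mem_index_enum b).
  by rewrite /= expf_eq0 /= (gt_eqF (x_gt0 b)).
by rewrite x1 => /eqP; rewrite oner_eq0.
Qed.

Lemma tilted_mean_ge0 x e : sqrt_distribution x -> (forall b, 0 <= e b) ->
  0 <= tilted_mean x e.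
Proof.
move=> xd e_ge0; rewrite divr_ge0 ?(ltW (sum_cube_gt0 xd)) //.
by apply: sumr_ge0 => b _; rewrite mulr_ge0 ?exprn_ge0 // ltW ?xd.1.
Qed.

Lemma sum_cube_centered x e : sqrt_distribution x ->
  \sum_b x b ^+ 3 * (e b - tilted_mean x e) = 0.
Proof.
move=> xd; under eq_bigr => b _ do rewrite mulrBr.
rewrite sumrB -mulr_suml /tilted_mean mulrCA mulfV ?mulr1 ?subrr //.
by rewrite gt_eqF ?sum_cube_gt0.
Qed.

Section Step.
Variables (eta kappa : R) (x e : V -> R).
Hypotheses (eta_gt0 : 0 < eta) (small : eta * kappa <= 1 / 2).
Hypotheses (xd : sqrt_distribution x) (e_ge0 : forall b, 0 <= e b).
Hypotheses (xe : forall b, x b * e b <= kappa).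
Hypotheses (xc : forall b, x b * tilted_mean x e <= kappa).

Let c := tilted_mean x e.
Let u b := eta * x b * (e b - c).

Let c_ge0 : 0 <= c. Proof. exact: tilted_mean_ge0. Qed.

(** [u b] is a difference of two numbers in [[0, eta * kappa]]. Hence the radicand of [mirror_step]
    stays at least 1/2 and the square root bounds apply. *)
Let u_small b : - (1 / 2) <= u b <= 1 / 2.
Proof.
have xb := xd.1 b; have := xe b; have := xc b; rewrite -/c => h1 h2.
have h3 : 0 <= x b * c by rewrite mulr_ge0 // ltW.
have h4 : 0 <= x b * e b by rewrite mulr_ge0 // ltW.
have -> : u b = eta * (x b * e b) - eta * (x b * c) by rewrite /u; ring.
have h5 : eta * (x b * e b) <= 1 / 2.
  by apply: le_trans small; rewrite ler_pM2l.
have h6 : eta * (x b * c) <= 1 / 2.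
  by apply: le_trans small; rewrite ler_pM2l.
have h7 : 0 <= eta * (x b * e b) by rewrite mulr_ge0 // ltW.
have h8 : 0 <= eta * (x b * c) by rewrite mulr_ge0 // ltW.
lra.
Qed.

Lemma mirror_step_distribution : sqrt_distribution (mirror_step eta x e).
Proof.
split=> [b|].
  rewrite /mirror_step mulr_gt0 ?xd.1 // sqrtr_gt0 -/c -/(u b).
  by have := u_small b; lra.
have E b : mirror_step eta x e b ^+ 2
    = x b ^+ 2 - eta * (x b ^+ 3 * (e b - c)).
  rewrite /mirror_step -/c exprMn sqr_sqrtr; first by ring.
  by have := u_small b; rewrite /u; lra.
under eq_bigr => b _ do rewrite E.
by rewrite sumrB xd.2 -mulr_sumr sum_cube_centered // mulr0 subr0.
Qed.

(** Expanding the square, the cross term is nonpositive and is dropped. The second-order term thus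
    becomes linear in the estimates, so that its expectation can be computed. *)
Let xsqr_le a : x a * (e a - c) ^+ 2 <= kappa * (e a + c).
Proof.
have xa := xd.1 a; have ea := e_ge0 a.
have h1 : x a * e a * e a <= kappa * e a by rewrite ler_wpM2r.
have h2 : x a * c * c <= kappa * c by rewrite ler_wpM2r // xc.
have h3 := mulr_ge0 (mulr_ge0 (ltW xa) ea) c_ge0.
by nra.
Qed.

(** The tangent bound controls [\sum_b x b] and the second-order bound controls [(x a)^-1]. Their
    first-order terms in [c] are [eta / 2 * c] with opposite signs and cancel. *)
Lemma potential_mirror_step a :
  potential a (mirror_step eta x e) <=
    potential a x + eta / 2 * (e a - \sum_b x b ^+ 2 * e b)
      + eta ^+ 2 * kappa * (e a + c).
Proof.
have S : \sum_b mirror_step eta x e b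
    <= \sum_b x b - eta / 2 * (\sum_b x b ^+ 2 * e b - c).
  have -> : \sum_b x b - eta / 2 * (\sum_b x b ^+ 2 * e b - c)
      = \sum_b x b * (1 - u b / 2).
    have -> : c = \sum_b c * x b ^+ 2 by rewrite -mulr_sumr xd.2 mulr1.
    rewrite -sumrB mulr_sumr -sumrB.
    by apply: eq_bigr => b _; rewrite /u; field.
  apply: ler_sum => b _; rewrite /mirror_step ler_pM2l ?xd.1 //.
  by apply: sqrt_1subr_le; rewrite -/c -/(u b); have := u_small b; lra.
have I : (mirror_step eta x e a)^-1
    <= (x a)^-1 + eta / 2 * (e a - c) + eta ^+ 2 * (x a * (e a - c) ^+ 2).
  have xa := xd.1 a.
  rewrite /mirror_step invfM.
  have -> : (x a)^-1 + eta / 2 * (e a - c) + eta ^+ 2 * (x a * (e a - c) ^+ 2)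
      = (x a)^-1 * (1 + u a / 2 + u a ^+ 2).
    by rewrite /u; field; rewrite gt_eqF.
  by rewrite ler_pM2l ?invr_gt0 //; apply: inv_sqrt_1subr_le; exact: u_small.
have Q : eta ^+ 2 * (x a * (e a - c) ^+ 2) <= eta ^+ 2 * (kappa * (e a + c)).
  by rewrite ler_wpM2l ?sqr_ge0.
by rewrite /potential; lra.
Qed.

End Step.

(** Cauchy-Schwarz, obtained from a termwise AM-GM inequality that is tight at the uniform
    distribution. *)
Lemma sum_sqrt_distribution_le x (K : R) : 0 < K -> K ^+ 2 = #|V|%:R ->
  sqrt_distribution x -> \sum_b x b <= K.
Proof.
move=> K_gt0 KK [_ x1].
have amgm b : x b <= (K * x b ^+ 2 + K^-1) / 2.
  rewrite -subr_ge0.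
  have -> : (K * x b ^+ 2 + K^-1) / 2 - x b = (K * x b - 1) ^+ 2 / (2 * K).
    by field; rewrite gt_eqF.
  by rewrite divr_ge0 ?sqr_ge0 // mulr_ge0 // ltW.
apply: (le_trans (ler_sum _ (fun b _ => amgm b))).
rewrite -mulr_suml big_split /= -mulr_sumr x1 sumr_const -[K^-1 *+ _]mulr_natr.
by rewrite -KK [leLHS](_ : _ = K) //; field; rewrite gt_eqF.
Qed.

Lemma max_cube_le_sum x : sqrt_distribution x ->
  exists m, [/\ 0 < m, forall b, x b <= m & m ^+ 3 <= \sum_b x b ^+ 3].
Proof.
move=> xd; have [b0|noV] := pickP (fun _ : V => true); last first.
  by have := xd.2; rewrite big_pred0 // => /eqP; rewrite eq_sym oner_eq0.
move=> _; pose am := [arg max_(i > b0) x i]%O.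
have am_max b : x b <= x am.
  by rewrite /am; case: arg_maxP => // i _; apply.
exists (x am); split=> //; first exact: xd.1.
rewrite (bigD1 am) //= lerDl sumr_ge0 // => b _.
by rewrite exprn_ge0 // ltW ?xd.1.
Qed.

End MirrorDescent.

(** * Forced exploration, importance-weighted estimates and the one-round inequality *)

Section Exploration.
Variables (R : realType) (V : finType) (f : V -> V) (gam : R).
Implicit Types (x e l : V -> R) (a b v : V).

Definition exploring_play x v : R :=
  (1 - gam) * x v ^+ 2 + gam * ((\sum_(b | f b == v) x b) / \sum_b x b).

(** Only a play of [f b] counts: the loss of [b] seen through any other arm is discarded, so the
    weight is a single play probability. *)
Definition loss_estimate x v l b : R :=
  if f b == v then l b / exploring_play x v else 0.

Hypotheses (gam_gt0 : 0 < gam) (gam_le1 : gam <= 1).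

Section Estimate.
Variable x : V -> R.
Hypothesis xd : sqrt_distribution x.

Let Z : R := \sum_b x b.
Let F v : R := \sum_(b | f b == v) x b.

Let F_ge0 v : 0 <= F v.
Proof. by apply: sumr_ge0 => b _; rewrite ltW ?xd.1. Qed.

Let le_F b v : f b = v -> x b <= F v.
Proof.
move=> fb; rewrite /F (bigD1 b) ?fb //= lerDl sumr_ge0 // => i _.
by rewrite ltW ?xd.1.
Qed.

Let Z_gt0 : 0 < Z.
Proof.
have [m [m_gt0 _ _]] := max_cube_le_sum xd.
rewrite lt_neqAle sumr_ge0 ?andbT; last by move=> b _; rewrite ltW ?xd.1.
apply/eqP => /esym/eqP; rewrite psumr_eq0 => [/allP xall|b _]; last first.
  by rewrite ltW ?xd.1.
have := xd.2; rewrite big1 => [/eqP|b _]; first by rewrite eq_sym oner_eq0.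
have := xall b (mem_index_enum b).
by rewrite /= (gt_eqF (xd.1 b)).
Qed.

Let bound_ge0 : 0 <= Z / gam.
Proof. by rewrite divr_ge0 ?(ltW Z_gt0) ?(ltW gam_gt0). Qed.

Let sum_F : \sum_v F v = Z.
Proof. by rewrite [RHS](partition_big f xpredT). Qed.

Lemma exploring_play_distribution : is_distribution (exploring_play x).
Proof.
split=> [v|].
  rewrite addr_ge0 // mulr_ge0 ?subr_ge0 ?sqr_ge0 ?(ltW gam_gt0) //.
  by rewrite divr_ge0 ?F_ge0 ?(ltW Z_gt0).
rewrite big_split /= -!mulr_sumr xd.2 -mulr_suml -/Z.
by rewrite [X in X / Z]sum_F divff ?gt_eqF // mulr1 mulr1 subrK.
Qed.

(** The exploration share alone gives this. With [le_F] it bounds [x b] by [Z / gam] times the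
    probability of playing [f b], which is why [Z / gam] serves as [kappa]. *)
Let play_lower v : F v <= Z / gam * exploring_play x v.
Proof.
have -> : Z / gam * exploring_play x v
    = F v + Z / gam * ((1 - gam) * x v ^+ 2).
  by rewrite /exploring_play -/Z -/(F v); field; rewrite !gt_eqF.
by rewrite lerDl mulr_ge0 // mulr_ge0 ?sqr_ge0 // subr_ge0.
Qed.

Let play_gt0 b : 0 < exploring_play x (f b).
Proof.
have h : 0 < Z / gam * exploring_play x (f b).
  exact: lt_le_trans (xd.1 b) (le_trans (le_F erefl) (play_lower _)).
by rewrite pmulr_rgt0 ?divr_gt0 in h.
Qed.

Lemma sum_play_loss_estimate l b :
  \sum_v exploring_play x v * loss_estimate x v l b = l b.
Proof.
rewrite (bigD1 (f b)) //= big1 => [|v v_fb]; last first.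
  by rewrite /loss_estimate eq_sym (negPf v_fb) mulr0.
by rewrite /loss_estimate eqxx addr0 mulrC divfK ?gt_eqF ?play_gt0.
Qed.

(** The tilted mean is linear in the estimates and its weights do not depend on the sampled arm, so
    unbiasedness passes to it. *)
Lemma sum_play_tilted_mean l :
  \sum_v exploring_play x v * tilted_mean x (loss_estimate x v l)
    = tilted_mean x l.
Proof.
under eq_bigr => v _ do rewrite /tilted_mean mulrA mulr_sumr.
rewrite -mulr_suml exchange_big /=; congr (_ / _); apply: eq_bigr => b _.
by rewrite -[in RHS](sum_play_loss_estimate l b) mulr_sumr;
  apply: eq_bigr => v _; rewrite mulrCA.
Qed.

Variable l : V -> R.
Hypothesis l01 : forall b, 0 <= l b <= 1.

Lemma loss_estimate_ge0 v b : 0 <= loss_estimate x v l b.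
Proof.
rewrite /loss_estimate; case: eqP => // <-.
by rewrite divr_ge0 ?(ltW (play_gt0 b)) //; case/andP: (l01 b).
Qed.

Lemma loss_estimate_le v b : x b * loss_estimate x v l b <= Z / gam.
Proof.
rewrite /loss_estimate; case: eqP => [<-|_]; last first.
  by rewrite mulr0.
rewrite mulrA ler_pdivrMr ?play_gt0 //.
apply: le_trans (play_lower _); apply: le_trans (le_F erefl).
by rewrite ler_piMr ?(ltW (xd.1 b)) //; case/andP: (l01 b).
Qed.

(** All nonzero estimates share the denominator [exploring_play x v]. Bounding [x b ^+ 3] by
    [m ^+ 2 * x b], with [m] the largest coordinate, collects them into [F v]; the factor [x a <= m]
    then completes [m ^+ 3], which the sum of cubes dominates. *)
Lemma tilted_mean_estimate_le v a :
  x a * tilted_mean x (loss_estimate x v l) <= Z / gam.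
Proof.
have [m [m_gt0 x_le_m m3]] := max_cube_le_sum xd.
have W_gt0 := sum_cube_gt0 xd.
rewrite /tilted_mean mulrA ler_pdivrMr //.
have x_gt0 := xd.1.
have S : \sum_b x b ^+ 3 * loss_estimate x v l b <= m ^+ 2 * (Z / gam).
  (* If no arm is explored through [v], the play probability of [v] may be 0 (when [gam = 1]), so no
     division by it is possible; but then all estimates vanish. *)
  have [b0 /eqP fb0|nov] := pickP (fun b => f b == v); last first.
    rewrite big1 => [|b _]; first by rewrite mulr_ge0 ?sqr_ge0.
    by rewrite /loss_estimate nov mulr0.
  have P_gt0 := play_gt0 b0; rewrite fb0 in P_gt0.
  apply: (@le_trans _ _ (m ^+ 2 * F v / exploring_play x v)); last first.
    rewrite -mulrA ler_pM2l ?exprn_gt0 // ler_pdivrMr //; exact: play_lower.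
  rewrite -mulrA mulrCA /F mulr_suml [leRHS]big_mkcond /=.
  apply: ler_sum => b _; rewrite /loss_estimate.
  case: eqP => fb; last by rewrite mulr0.
  rewrite [leLHS]mulrA [leRHS]mulrA ler_pM2r ?invr_gt0 //.
  have [l0 l1] := andP (l01 b).
  apply: (@le_trans _ _ (x b ^+ 3)).
    by rewrite ler_piMr // exprn_ge0 // ltW.
  rewrite exprS ler_pM2l //.
  by rewrite ler_pXn2r ?nnegrE ?(ltW (x_gt0 b)) ?(ltW m_gt0).
apply: (@le_trans _ _ (m * (m ^+ 2 * (Z / gam)))).
  apply: ler_pM => //; first exact: ltW.
  apply: sumr_ge0 => b _; rewrite mulr_ge0 ?loss_estimate_ge0 //.
  by rewrite exprn_ge0 ?(ltW (x_gt0 b)).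
by rewrite mulrA -exprS mulrC ler_pM2l ?divr_gt0.
Qed.

(** The factor [2 / eta] normalizes the first-order drift to [e a] minus the [p]-mean of [e], whose
    expectation compares [l a] with the loss of [p]. Exploration adds at most [gam]; the
    second-order term has expectation at most [2 * eta * (Z / gam)] times 2, since [l a] and the
    tilted mean of [l] are at most 1. *)
Lemma exploring_step eta a : 0 < eta -> eta * (Z / gam) <= 1 / 2 ->
  \sum_v exploring_play x v *
     (l v + 2 / eta * potential a (mirror_step eta x (loss_estimate x v l)))
    <= l a + 2 / eta * potential a x + (gam + 4 * eta * (Z / gam)).
Proof.
move=> eta_gt0 small; have [P_ge0 P1] := exploring_play_distribution.
pose P := exploring_play x; pose e v := loss_estimate x v l.
have drift v : 2 / eta * potential a (mirror_step eta x (e v))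
    <= 2 / eta * potential a x + (e v a - \sum_b x b ^+ 2 * e v b)
       + 2 * eta * (Z / gam) * (e v a + tilted_mean x (e v)).
  have h := potential_mirror_step eta_gt0 small xd (loss_estimate_ge0 v)
    (loss_estimate_le v) (tilted_mean_estimate_le v) a.
  rewrite -(ler_pM2l (_ : 0 < 2 / eta)) in h; last by rewrite divr_gt0.
  apply: (le_trans h); rewrite le_eqVlt; apply/orP; left; apply/eqP.
  by rewrite -/(e v); field; rewrite ?gt_eqF.
have E1 : \sum_v P v * e v a = l a by exact: sum_play_loss_estimate.
have E2 : \sum_v P v * (\sum_b x b ^+ 2 * e v b) = \sum_b x b ^+ 2 * l b.
  under eq_bigr => w _ do rewrite mulr_sumr.
  rewrite exchange_big /=; apply: eq_bigr => b _.
  rewrite -(sum_play_loss_estimate l b) mulr_sumr.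
  by apply: eq_bigr => w _; rewrite mulrCA.
have E3 : \sum_v P v * tilted_mean x (e v) <= 1.
  rewrite sum_play_tilted_mean /tilted_mean ler_pdivrMr ?sum_cube_gt0 // mul1r.
  apply: ler_sum => b _; rewrite ler_piMr ?exprn_ge0 ?(ltW (xd.1 b)) //.
  by case/andP: (l01 b).
have E4 : \sum_v P v * l v <= \sum_b x b ^+ 2 * l b + gam.
  (* [gam] is spread over the arms as [gam * F v / Z], to compare term by term. *)
  rewrite -[X in _ + X]mulr1 -[X in _ * X](divff (lt0r_neq0 Z_gt0)).
  rewrite -[X in X / Z]sum_F mulr_suml mulr_sumr -big_split /=.
  apply: ler_sum => v _; have [l0 l1] := andP (l01 v).
  rewrite /P /exploring_play mulrDl lerD //.
    by rewrite ler_wpM2r // ler_piMl ?sqr_ge0 // gerBl ltW.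
  by rewrite ler_piMr // mulr_ge0 ?divr_ge0 ?F_ge0 ?(ltW Z_gt0) ?(ltW gam_gt0).
apply: (@le_trans _ _ (\sum_v (P v * l v + P v * (2 / eta * potential a x)
   + (P v * e v a - P v * (\sum_b x b ^+ 2 * e v b))
   + 2 * eta * (Z / gam) * (P v * e v a + P v * tilted_mean x (e v))))).
  apply: ler_sum => v _.
  have := ler_wpM2l (P_ge0 v) (drift v); rewrite -/(P v) -/(e v) !mulrDr; lra.
rewrite !big_split /= -mulr_suml P1 sumrN -!mulr_sumr big_split /= E1 E2.
have la1 : l a <= 1 by case/andP: (l01 a).
have k_ge0 : 0 <= 2 * eta * (Z / gam).
  by rewrite !mulr_ge0 ?invr_ge0 ?(ltW Z_gt0) ?(ltW gam_gt0) ?(ltW eta_gt0).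
have h : 2 * eta * (Z / gam) * (l a + \sum_v P v * tilted_mean x (e v))
    <= 2 * eta * (Z / gam) * 2 by rewrite ler_wpM2l //; lra.
lra.
Qed.

End Estimate.
End Exploration.

(** * From a one-round inequality to a regret bound *)

Section Telescoping.
Variables (R : realType) (V : finType) (E : rel V).
Variables (A : history R V -> V -> R) (L : nat -> V -> R).

Lemma sum_tuple_rcons T (F : T.+1.-tuple V -> R) :
  \sum_s F s = \sum_(s : T.-tuple V) \sum_v F [tuple of rcons s v].
Proof.
rewrite pair_bigA /=.
pose g (p : T.-tuple V * V) := [tuple of rcons p.1 p.2].
have g_inj : injective g.
  move=> [s v] [s' v'] /(congr1 val) /= /rcons_inj[/val_inj -> ->] //.
rewrite (reindex g) //; apply: onW_bij; apply: inj_card_bij => //.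
by rewrite card_prod !card_tuple expnSr.
Qed.

Lemma history_of_rcons (s : seq V) v :
  history_of E L (rcons s v)
    = rcons (history_of E L s) (v, feedback E (L (size s)) v).
Proof.
rewrite /history_of size_rcons -addn1 iotaD -cats1 zip_cat ?size_iota //.
by rewrite map_cat cats1.
Qed.

Lemma play_prob_rcons T (s : T.-tuple V) v :
  play_prob E A L [tuple of rcons s v]
    = play_prob E A L s * A (history_of E L s) v.
Proof.
rewrite /play_prob big_ord_recr /=; congr (_ * _); last first.
  rewrite (tnth_nth v) /= nth_rcons size_tuple ltnn eqxx.
  by rewrite -cats1 takel_cat ?size_tuple // take_oversize ?size_tuple.
apply: eq_bigr => i _; rewrite !(tnth_nth v) /= nth_rcons size_tuple ltn_ord.
by rewrite -cats1 takel_cat ?size_tuple // ltnW.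
Qed.

Hypothesis A_alg : is_algorithm A.

Lemma play_prob_ge0 T (s : T.-tuple V) : 0 <= play_prob E A L s.
Proof.
by apply: prodr_ge0 => i _; case: (A_alg (history_of E L (take i s))).
Qed.

Lemma sum_play_prob T : \sum_(s : T.-tuple V) play_prob E A L s = 1.
Proof.
elim: T => [|T IH].
  rewrite (big_pred1 [tuple]); first by rewrite /play_prob big_ord0.
  by move=> s; apply/esym/eqP; exact: tuple0.
rewrite sum_tuple_rcons -[RHS]IH; apply: eq_bigr => s _.
under eq_bigr => v _ do rewrite play_prob_rcons.
by rewrite -mulr_sumr (A_alg _).2 mulr1.
Qed.

(** Induction on [T] on the expected loss plus final potential; nonnegativity of [Phi] discards the
    latter at the end. Since [L] is fixed, the arms determine the history, so [Phi] may take the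
    sequence of arms. *)
Lemma regret_le_potential (Phi : seq V -> R) (a : V) (k : R) T :
  (forall s, 0 <= Phi s) ->
  (forall s, \sum_v A (history_of E L s) v *
                (L (size s) v + Phi (rcons s v))
             <= L (size s) a + Phi s + k) ->
  regret E T A L a <= Phi [::] + k * T%:R.
Proof.
move=> Phi_ge0 step.
have main : \sum_(s : T.-tuple V) play_prob E A L s *
      (\sum_(t < T) L t (tnth s t) + Phi s)
    <= cumulative_loss T L a + (Phi [::] + k * T%:R).
  elim: T => [|T IH].
    rewrite (big_pred1 [tuple]) => [|s]; last exact/esym/eqP/tuple0.
    by rewrite /play_prob /cumulative_loss !big_ord0 mul1r mulr0 addr0 add0r.
  rewrite sum_tuple_rcons.
  apply: (@le_trans _ _ (\sum_(s : T.-tuple V) (play_prob E A L s *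
      (\sum_(t < T) L t (tnth s t) + Phi s)
      + play_prob E A L s * (L T a + k)))).
    apply: ler_sum => s _.
    under eq_bigr => v _.
      rewrite play_prob_rcons big_ord_recr /= (tnth_nth v) /=.
      rewrite nth_rcons size_tuple ltnn eqxx.
      under eq_bigr => i _.
        rewrite (tnth_nth v) /= nth_rcons size_tuple ltn_ord -tnth_nth.
        over.
      rewrite -addrA -mulrA mulrDr.
      over.
    rewrite -mulr_sumr -mulrDr ler_wpM2l ?play_prob_ge0 //.
    rewrite big_split /= -mulr_suml (A_alg _).2 mul1r -!addrA lerD2l.
    have := step s; rewrite size_tuple; lra.
  rewrite big_split /= -mulr_suml sum_play_prob mul1r.
  rewrite /cumulative_loss big_ord_recr /= -natr1.
  by move: IH; rewrite /cumulative_loss; lra.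
rewrite /regret lerBlDl; apply: le_trans main.
apply: ler_sum => s _; rewrite ler_wpM2l ?play_prob_ge0 //.
by rewrite lerDl.
Qed.

End Telescoping.

(** * The algorithm and its regret for general parameters *)

Section ExploringMirrorDescent.
Variables (R : realType) (V : finType) (E : rel V) (f : V -> V) (gam eta : R).

(* Clipping matters only on histories that no loss sequence produces: there the
   recorded values may lie outside [0, 1]. *)
Definition observed_loss (o : {ffun V -> option R}) (b : V) : R :=
  if o b is Some y then Num.max 0 (Num.min 1 y) else 0.

Definition descent_state (h : history R V) : V -> R :=
  foldl (fun x r => mirror_step eta x
                      (loss_estimate f gam x r.1 (observed_loss r.2)))
        (fun=> (Num.sqrt #|V|%:R)^-1) h.

Definition exploring_descent (h : history R V) : V -> R :=
  exploring_play f gam (descent_state h).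

Let K : R := Num.sqrt #|V|%:R.

Hypotheses (V_gt0 : (0 < #|V|)%N) (f_in : forall b, E (f b) b).
Hypotheses (gam_gt0 : 0 < gam) (gam_le1 : gam <= 1).
Hypotheses (eta_gt0 : 0 < eta) (small : eta * (K / gam) <= 1 / 2).

Let K_gt0 : 0 < K. Proof. by rewrite sqrtr_gt0 ltr0n. Qed.

Let K_sqr : K ^+ 2 = #|V|%:R. Proof. by rewrite sqr_sqrtr. Qed.

Let le_K (x : V -> R) : sqrt_distribution x ->
  eta * ((\sum_b x b) / gam) <= eta * (K / gam).
Proof.
move=> xd; rewrite ler_pM2l // ler_pM2r ?invr_gt0 //.
exact: sum_sqrt_distribution_le.
Qed.

Lemma observed_loss_bounds o b : 0 <= observed_loss o b <= 1.
Proof.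
rewrite /observed_loss; case: (o b) => [y|]; last by rewrite lexx ler01.
by rewrite le_max lexx /= ge_max ler01 ge_min lexx.
Qed.

(** This covers every history, as [is_algorithm] requires: clipping keeps the recorded losses in the
    range that the estimate bounds assume. *)
Lemma descent_state_distribution h : sqrt_distribution (descent_state h).
Proof.
elim/last_ind: h => [|h [v o] IH].
  split=> [b|]; first by rewrite invr_gt0.
  rewrite /descent_state /= sumr_const -/K -[_ *+ _]mulr_natr -K_sqr.
  by rewrite exprVn mulVf ?gt_eqF ?exprn_gt0.
rewrite /descent_state foldl_rcons -/(descent_state h) /=.
have lb := observed_loss_bounds o.
apply: (mirror_step_distribution eta_gt0 (le_trans (le_K IH) small)) => //.
- exact: loss_estimate_ge0.
- exact: loss_estimate_le.
- exact: tilted_mean_estimate_le.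
Qed.

Lemma exploring_descent_algorithm : is_algorithm exploring_descent.
Proof.
move=> h; apply: exploring_play_distribution => //.
exact: descent_state_distribution.
Qed.

(** The estimate reads [l] only at arms [b] with [f b = v], which are observed by [f_in]; so the
    algorithm can compute the estimate used in the analysis. *)
Lemma loss_estimate_feedback x l v : (forall b, 0 <= l b <= 1) ->
  loss_estimate f gam x v (observed_loss (feedback E l v))
    = loss_estimate f gam x v l.
Proof.
move=> l01; apply/funext => b; rewrite /loss_estimate.
case: eqP => // fb; congr (_ / _); rewrite /observed_loss ffunE -fb inE f_in.
by have /andP[l0 l1] := l01 b; rewrite min_r // max_r.
Qed.

Lemma exploring_descent_regret (L : nat -> V -> R) a T : is_loss_sequence L ->
  regret E T exploring_descent L a
    <= 4 * K / eta + (gam + 4 * (eta * (K / gam))) * T%:R.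
Proof.
move=> L01.
pose Phi s := 2 / eta * potential a (descent_state (history_of E L s)).
(* At the uniform state, [\sum_b x b] and [(x a)^-1] both equal [K]. *)
have Phi0 : Phi [::] = 4 * K / eta.
  rewrite /Phi /potential /descent_state /= sumr_const -/K invrK.
  rewrite -[K^-1 *+ _]mulr_natr -K_sqr.
  by field; rewrite !gt_eqF.
rewrite -Phi0; apply: regret_le_potential => [|s|s].
- exact: exploring_descent_algorithm.
- have xd := descent_state_distribution (history_of E L s).
  rewrite /Phi mulr_ge0 ?divr_ge0 ?(ltW eta_gt0) // addr_ge0 ?invr_ge0 //.
    by apply: sumr_ge0 => b _; rewrite (ltW (xd.1 b)).
  by rewrite (ltW (xd.1 a)).
have xd := descent_state_distribution (history_of E L s).
rewrite /exploring_descent /Phi; set x := descent_state (history_of E L s).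
under eq_bigr => v _.
  rewrite history_of_rcons /descent_state foldl_rcons -/(descent_state _) /=.
  rewrite loss_estimate_feedback //.
  over.
have h := exploring_step f gam_gt0 gam_le1 xd (L01 (size s)) a eta_gt0
  (le_trans (le_K xd) small).
apply: (le_trans h); rewrite lerD2l lerD2l -mulrA ler_pM2l //.
exact: le_K.
Qed.

End ExploringMirrorDescent.

(** * Choice of in-neighbours and tuning of the parameters *)

Lemma weakly_observable_in_neighbour (V : finType) (E : rel V) :
  weakly_observable E -> exists f : V -> V, forall b, E (f b) b.
Proof.
case/andP => /existsPn obs _.
have nb b : exists u, E u b.
  by have /set0Pn[u] := obs b; rewrite inE => Eub; exists u.
by exists (fun b => xchoose (nb b)) => b; exact: (xchooseP (nb b)).
Qed.

Theorem mainTheorem5 (R : realType) :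
  exists2 c : R, 0 < c &
    forall (V : finType) (E : rel V), weakly_observable E ->
      exists T0 : nat, forall T : nat, (T0 <= T)%N ->
        (minimax_regret R E T
           <= (c * #|V|%:R `^ (1 / 3) * T%:R `^ (2 / 3))%:E)%E.
Proof.
(* In units of [n3 * t3 ^+ 2]: 4 from the initial potential, 1 from exploration and 4 from the
   second-order term. *)
exists 9 => // V E wo; have [f f_in] := weakly_observable_in_neighbour wo.
have V_gt0 : (0 < #|V|)%N.
  by case/andP: wo => _ /forallPn[v _]; apply/card_gt0P; exists v.
(* Taking cube roots, this threshold says [2 * n3 <= t3], that is [gam <= 1 / 2]; as
   [eta * (K / gam) = gam], it is also the smallness condition on the step. *)
exists (8 * #|V|)%N => T T_ge.
have T_gt0 : (0 < T)%N by apply: leq_trans T_ge; rewrite muln_gt0.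
have cube (n : nat) : (n%:R `^ (1 / 3) : R) ^+ 3 = n%:R.
  rewrite -powR_mulrn ?powR_ge0 // -powRrM.
  by rewrite [1 / 3 * _](_ : _ = 1) ?powRr1 //; field.
have pos (n : nat) : (0 < n)%N -> 0 < n%:R `^ (1 / 3) :> R.
  by move=> n_gt0; rewrite powR_gt0 // ltr0n.
set n3 : R := #|V|%:R `^ (1 / 3); set t3 : R := T%:R `^ (1 / 3).
have T2 : T%:R `^ (2 / 3) = t3 ^+ 2 :> R.
  by rewrite -powR_mulrn ?powR_ge0 // -powRrM; congr (_ `^ _); field.
have n3_gt0 : 0 < n3 by exact: pos.
have t3_gt0 : 0 < t3 by exact: pos.
have nt : 2 * n3 <= t3.
  rewrite -(@ler_pXn2r _ 3) ?nnegrE ?(ltW t3_gt0) ?mulr_ge0 ?(ltW n3_gt0) //.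
  by rewrite exprMn !cube -natrX -natrM ler_nat.
pose K : R := Num.sqrt #|V|%:R.
have K_gt0 : 0 < K by rewrite sqrtr_gt0 ltr0n.
have K2 : K ^+ 2 = n3 ^+ 3 by rewrite cube sqr_sqrtr.
pose gam := n3 / t3; pose eta := gam ^+ 2 / K.
have gam_gt0 : 0 < gam by rewrite divr_gt0.
have gam_le : gam <= 1 / 2 by rewrite ler_pdivrMr //; lra.
have eta_gt0 : 0 < eta by rewrite divr_gt0 ?exprn_gt0.
have ek : eta * (K / gam) = gam by rewrite /eta; field; rewrite !gt_eqF.
have gam_le1 : gam <= 1 by lra.
have small : eta * (K / gam) <= 1 / 2 by rewrite ek.
have le_wc : (minimax_regret R E T
    <= worst_case_regret E T (exploring_descent f gam eta))%E.
  apply: ereal_inf_lbound; exists (exploring_descent f gam eta) => //.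
  exact: exploring_descent_algorithm.
apply: (le_trans le_wc).
apply: ge_ereal_sup => _ [L [a [L01 _ ->]]]; rewrite lee_fin T2.
apply: le_trans (exploring_descent_regret V_gt0 f_in gam_gt0 gam_le1 eta_gt0
  small a T L01) _.
rewrite ek -(cube T) -/t3 le_eqVlt; apply/orP; left; apply/eqP.
have -> : 4 * K / eta = 4 * n3 * t3 ^+ 2.
  have -> : 4 * K / eta = 4 * K ^+ 2 / gam ^+ 2.
    by rewrite /eta; field; rewrite !gt_eqF.
  by rewrite K2 /gam; field; rewrite !gt_eqF.
by rewrite /gam; field; rewrite gt_eqF.
Qed.
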